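(* Let $L^2$ be the Lobachevsky plane with the metric $ds^2=du^2+e^{2u}dv^2$, and let $X_1=\partial_u$, $X_2=e^{-u}\partial_v$. For real constants $a,b$ let $\omega=au+b$ and $\xi=\cos\omega\,X_1+\sin\omega\,X_2$ (so $\omega$ is the angle function of $\xi$ with respect to the $u$-geodesics). Then the hypersurface $\xi(L^2)\subset T_1L^2$ has constant mean curvature $$H=\frac{a}{2\sqrt{2+a^2}} .$$
   Context: $T_1M$ is the unit tangent sphere bundle with the Sasaki metric. With $\pi:TM\to M$ the projection and $K:T_{(Q,\xi)}TM\to T_QM$ the connection map, in induced coordinates $K\big(A^i\partial_{u^i}+B^i\partial_{\xi^i}\big)=(B^i+\Gamma^i_{jk}\xi^jA^k)\partial_{u^i}$, the Sasaki metric is $\langle\langle\tilde X,\tilde Y\rangle\rangle=\langle\pi_*\tilde X,\pi_*\tilde Y\rangle+\langle K\tilde X,K\tilde Y\rangle$, and $T_1M\subset TM$ has the induced metric. The horizontal lift $X^H$ and vertical lift $X^V$ of $X\in T_QM$ are determined by $\pi_*X^H=X,\ KX^H=0$ and $\pi_*X^V=0,\ KX^V=X$. A unit vector field $\xi$ on $M$ is regarded as a map $M\to T_1M$, with image the submanifold $\xi(M)$. If $\dim M=2$, the mean curvature of $\xi(M)$ is $H=\frac12\,\mathrm{trace}\,\tilde\Omega_{\tilde n}$, where $\tilde\Omega_{\tilde n}(\tilde X,\tilde Y)=\langle\langle\tilde\nabla_{\tilde X}\tilde Y,\tilde n\rangle\rangle$, $\tilde\nabla$ is the Levi-Civita connection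 of $T_1M$ and $\tilde n$ is a unit normal field of $\xi(M)$ in $T_1M$ (changing $\tilde n$ to $-\tilde n$ changes the sign of $H$). Here $\tilde n$ is the normalization of $-[(\nabla\xi)^*\eta]^H+\eta^V$, with $\eta=-\sin\omega\,X_1+\cos\omega\,X_2$ and $(\nabla\xi)^*$ defined by $\langle(\nabla\xi)^*X,Y\rangle=\langle X,\nabla_Y\xi\rangle$ for $X\perp\xi$. *)

(* Defs.v *)
(* Everything is written in coordinates: a Riemannian
   metric on R^n is a matrix field, tangent vectors are row vectors, TR^n is
   'rV_(n + n) with a point (Q, xi) stored as [row_mx Q xi]. *)
From HB Require Import structures.
From mathcomp Require Import all_boot all_order all_algebra.
From mathcomp Require Import all_classical all_reals all_analysis.
From mathcomp Require Import ring lra.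

Set Implicit Arguments.
Unset Strict Implicit.
Unset Printing Implicit Defensive.

Import Order.TTheory GRing.Theory Num.Theory.
Import numFieldNormedType.Exports.
Local Open Scope classical_set_scope.
Local Open Scope ring_scope.

Section LeviCivita.
Variables (R : realType) (n : nat).
Implicit Types (g : 'rV[R]_n -> 'M[R]_n) (p : 'rV[R]_n) (X Y : 'rV[R]_n).

Definition inner (G : 'M[R]_n) X Y : R := (X *m G *m Y^T) 0 0.

Definition ebasis (i : 'I_n) : 'rV[R]_n := delta_mx 0 i.

Definition pd_metric g p (l i j : 'I_n) : R :=
  'D_(ebasis l) (fun q => g q i j) p.

(* Gamma^i_{jk} *)
Definition christoffel g p (i j k : 'I_n) : R :=
  2^-1 * \sum_(l < n) invmx (g p) i l *
    (pd_metric g p j l k + pd_metric g p k l j - pd_metric g p l j k).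

(* Gamma^i_{jk} X^j Y^k *)
Definition christoffel_form g p X Y : 'rV[R]_n :=
  \row_i \sum_(j < n) \sum_(k < n) christoffel g p i j k * X 0 j * Y 0 k.

(* nabla_Y Z at p, for the Levi-Civita connection of g *)
Definition nabla g (Z : 'rV[R]_n -> 'rV[R]_n) p Y : 'rV[R]_n :=
  'D_Y Z p + christoffel_form g p Y (Z p).

(* The Levi-Civita connection of g pulled back by a map f into R^n: the
   derivative, in the direction v, of the vector field Z along f. *)
Definition nabla_along m g (f Z : 'rV[R]_m -> 'rV[R]_n) (p v : 'rV[R]_m) :
    'rV[R]_n :=
  'D_v Z p + christoffel_form g (f p) ('D_v f p) (Z p).

Lemma christoffel_sym g p i j k :
  (forall q, (g q)^T = g q) -> christoffel g p i j k = christoffel g p i k j.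
Proof.
move=> gT; rewrite /christoffel; congr (_ * _); apply: eq_bigr => l _.
congr (_ * _); rewrite [X in X - _]addrC; congr (_ - _).
by rewrite /pd_metric; congr derive; apply/funext => q; rewrite -{1}gT mxE.
Qed.

Lemma christoffel_metric g p (i j k : 'I_n) :
  (forall q, (g q)^T = g q) -> g p \in unitmx ->
  pd_metric g p k i j =
    \sum_(l < n) (christoffel g p l k i * g p l j +
                  christoffel g p l k j * g p i l).
Proof.
move=> gT gU.
have sym l a b : pd_metric g p l a b = pd_metric g p l b a.
  by rewrite /pd_metric; congr derive; apply/funext => q; rewrite -{1}gT mxE.
have lower a b c : \sum_(l < n) g p c l * christoffel g p l a b =
    2^-1 * (pd_metric g p a c b + pd_metric g p b c a - pd_metric g p c a b).
  pose w := \col_l (pd_metric g p a l b + pd_metric g p b l a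
                    - pd_metric g p l a b).
  have -> : pd_metric g p a c b + pd_metric g p b c a - pd_metric g p c a b
      = (g p *m (invmx (g p) *m w)) c 0 by rewrite mulKVmx // !mxE.
  rewrite mxE mulr_sumr; apply: eq_bigr => l _.
  rewrite mulrCA; congr (_ * _); rewrite /christoffel mxE; congr (_ * _).
  by apply: eq_bigr => m _; rewrite mxE.
have gs a b : g p a b = g p b a by rewrite -{1}gT mxE.
rewrite big_split /=.
under eq_bigr => l _ do rewrite mulrC gs.
under [X in _ + X]eq_bigr => l _ do rewrite mulrC.
rewrite !lower (sym k j i) (sym i j k) (sym j k i); by field.
Qed.

End LeviCivita.

Section Sasaki.
Variables (R : realType) (n : nat) (g : 'rV[R]_n -> 'M[R]_n).
Implicit Types (z A B : 'rV[R]_(n + n)) (Q X Y xi : 'rV[R]_n).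

Definition base z : 'rV[R]_n := lsubmx z.
Definition fibre z : 'rV[R]_n := rsubmx z.

Definition dproj A : 'rV[R]_n := lsubmx A.

Definition connection_map z A : 'rV[R]_n :=
  rsubmx A + christoffel_form g (base z) (fibre z) (lsubmx A).

Definition sasaki z A B : R :=
  inner (g (base z)) (dproj A) (dproj B) +
  inner (g (base z)) (connection_map z A) (connection_map z B).

Definition hlift z X : 'rV[R]_(n + n) :=
  row_mx X (- christoffel_form g (base z) (fibre z) X).

Definition vlift X : 'rV[R]_(n + n) := row_mx 0 X.

Lemma hliftP z X A :
  A = hlift z X <-> dproj A = X /\ connection_map z A = 0.
Proof.
rewrite /dproj /connection_map; split=> [->|[<- /eqP]].
  by rewrite row_mxKl row_mxKr addNr.
by rewrite addr_eq0 => /eqP BE; rewrite /hlift -BE hsubmxK.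
Qed.

Lemma vliftP z X A : A = vlift X <-> dproj A = 0 /\ connection_map z A = X.
Proof.
have C0 Q xi : christoffel_form g Q xi 0 = 0.
  apply/rowP => i; rewrite !mxE big1 // => j _; rewrite big1 // => k _.
  by rewrite mxE mulr0.
rewrite /dproj /connection_map; split=> [->|[A0]].
  by rewrite row_mxKl row_mxKr C0 addr0.
by rewrite A0 C0 addr0 => BE; rewrite /vlift -A0 -BE hsubmxK.
Qed.

Definition unit_tangent : set 'rV[R]_(n + n) :=
  [set z | inner (g (base z)) (fibre z) (fibre z) = 1].

Definition section (xi : 'rV[R]_n -> 'rV[R]_n) Q : 'rV[R]_(n + n) :=
  row_mx Q (xi Q).

(* Matrix, acting on row vectors, of Y |-> nabla_Y xi at Q. *)
Definition nabla_mx (xi : 'rV[R]_n -> 'rV[R]_n) Q : 'M[R]_n :=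
  \matrix_(i < n) nabla g xi Q (ebasis R i).

Definition nabla_adj (xi : 'rV[R]_n -> 'rV[R]_n) Q X : 'rV[R]_n :=
  X *m g Q *m (nabla_mx xi Q)^T *m invmx (g Q).

Lemma nabla_adjP (xi : 'rV[R]_n -> 'rV[R]_n) Q X Y :
  differentiable xi Q -> g Q \in unitmx ->
  inner (g Q) (nabla_adj xi Q X) Y = inner (g Q) X (nabla g xi Q Y).
Proof.
move=> dxi gU.
have -> : nabla g xi Q Y = Y *m nabla_mx xi Q.
  rewrite mulmx_sum_row {1}[Y]row_sum_delta.
  pose C := \matrix_(j, i) \sum_(k < n) christoffel g Q i j k * xi Q 0 k.
  have CE Z : christoffel_form g Q Z (xi Q) = Z *m C.
    apply/rowP => c; rewrite !mxE; apply: eq_bigr => j _; rewrite mxE mulr_sumr.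
    by apply: eq_bigr => k _; rewrite mulrCA mulrA.
  rewrite /nabla deriveE // linear_sum CE mulmx_suml -big_split /=.
  apply: eq_bigr => i _; rewrite rowK /nabla deriveE // CE linearZ scalerDr.
  by rewrite scalemxAl.
by rewrite /inner /nabla_adj mulmxKV // trmx_mul !mulmxA.
Qed.

End Sasaki.

Section UnitField.
Variables (R : realType) (g : 'rV[R]_2 -> 'M[R]_2).
Variables X1 X2 : 'rV[R]_2 -> 'rV[R]_2.

(* The coordinates (Q, theta) on T_1M given by an orthonormal frame X1, X2;
   theta is only determined modulo 2 pi, so this is a covering of T_1M by R^3
   rather than a bijection. *)
Definition angle_chart (w : 'rV[R]_(2 + 1)) : 'rV[R]_(2 + 2) :=
  let Q := lsubmx w in let theta := rsubmx w 0 0 in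
  row_mx Q (cos theta *: X1 Q + sin theta *: X2 Q).

(* The metric of T_1M in these coordinates, induced by the Sasaki metric. *)
Definition unit_tangent_metric (w : 'rV[R]_(2 + 1)) : 'M[R]_(2 + 1) :=
  \matrix_(i, j) sasaki g (angle_chart w)
     ('D_(ebasis R i) angle_chart w) ('D_(ebasis R j) angle_chart w).

(* The vector field with angle function omega, and its rotation by pi/2. *)
Definition angle_field (omega : 'rV[R]_2 -> R) Q : 'rV[R]_2 :=
  cos (omega Q) *: X1 Q + sin (omega Q) *: X2 Q.

Definition angle_conormal (omega : 'rV[R]_2 -> R) Q : 'rV[R]_2 :=
  - sin (omega Q) *: X1 Q + cos (omega Q) *: X2 Q.

(* The section [angle_field omega], read in the coordinates of T_1M. *)
Definition angle_section (omega : 'rV[R]_2 -> R) Q : 'rV[R]_(2 + 1) :=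
  row_mx Q (omega Q)%:M.

Lemma angle_chart_section omega Q :
  angle_chart (angle_section omega Q) = section (angle_field omega) Q.
Proof.
by rewrite /angle_chart /angle_section row_mxKl row_mxKr mxE eqxx mulr1n.
Qed.

(* Unit normal field of the image of xi, as tangent vectors of TM. *)
Definition normal_field (xi eta : 'rV[R]_2 -> 'rV[R]_2) Q : 'rV[R]_(2 + 2) :=
  hlift g (section xi Q) (- nabla_adj g xi Q (eta Q)) + vlift (eta Q).

Definition unit_normal (xi eta : 'rV[R]_2 -> 'rV[R]_2) Q : 'rV[R]_(2 + 2) :=
  let N := normal_field xi eta Q in
  (Num.sqrt (sasaki g (section xi Q) N N))^-1 *: N.

(* First and second fundamental forms, in the frame of coordinate vectors, of
   the surface of T_1M parametrized by f in the coordinates (Q, theta).  The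
   normal N is a tangent vector of TM at [angle_chart (f Q)], so the covariant
   derivatives in T_1M are pushed forward to TM before pairing them with N. *)
Definition first_form (f : 'rV[R]_2 -> 'rV[R]_(2 + 1)) Q : 'M[R]_2 :=
  \matrix_(i, j) inner (unit_tangent_metric (f Q))
     ('D_(ebasis R i) f Q) ('D_(ebasis R j) f Q).

Definition second_form (f : 'rV[R]_2 -> 'rV[R]_(2 + 1))
    (N : 'rV[R]_2 -> 'rV[R]_(2 + 2)) Q : 'M[R]_2 :=
  \matrix_(i, j) sasaki g (angle_chart (f Q))
     ('D_(nabla_along unit_tangent_metric f ('D_(ebasis R j) f) Q (ebasis R i))
        angle_chart (f Q))
     (N Q).

Definition mean_curvature (f : 'rV[R]_2 -> 'rV[R]_(2 + 1))
    (N : 'rV[R]_2 -> 'rV[R]_(2 + 2)) Q : R :=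
  2^-1 * \tr (invmx (first_form f Q) *m second_form f N Q).

End UnitField.

Section Lobachevsky.
Variable R : realType.
Implicit Types Q : 'rV[R]_2.

Definition ucoord Q : R := Q 0 0.

(* du^2 + e^{2u} dv^2 on R^2, with Q = (u, v) *)
Definition lobachevsky Q : 'M[R]_2 :=
  diag_mx (\row_(i < 2) if i == 0 then 1 else expR (2 * ucoord Q)).

Definition frame1 Q : 'rV[R]_2 := ebasis R 0.

Definition frame2 Q : 'rV[R]_2 := expR (- ucoord Q) *: ebasis R 1.

Lemma range_angle_chart :
  range (angle_chart frame1 frame2) = unit_tangent lobachevsky.
Proof.
have innerE Q X : inner (lobachevsky Q) X X
    = X 0 0 ^+ 2 + (expR (ucoord Q) * X 0 1) ^+ 2.
  rewrite /inner mul_mx_diag mxE !big_ord_recl big_ord0 !mxE /=.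
  rewrite (_ : lift ord0 ord0 = 1); last exact/val_inj.
  by rewrite mulr1 addr0 expRM_natl; ring.
have e0 Q : expR (ucoord Q) != 0 by rewrite gt_eqF ?expR_gt0.
apply/seteqP; split => [_ [w _ <-]|z] /=.
  rewrite /unit_tangent /= /base /fibre /angle_chart row_mxKl row_mxKr innerE.
  rewrite !mxE /= !mulr1 !mulr0 addr0 add0r expRN mulrCA mulfV // mulr1.
  exact: cos2Dsin2.
rewrite /unit_tangent /= innerE; set x := fibre z 0 0; set y := _ * _ => xy.
have y2 : 0 <= y ^+ 2 by exact: sqr_ge0.
have x1 : -1 <= x <= 1 by apply/andP; split; nra.
have [t [ct st]] : exists t, cos t = x /\ sin t = y.
  have c : cos (acos x) = x by rewrite acosK // in_itv.
  have s : sin (acos x) = `|y| by rewrite sin_acos // -xy addrC addKr sqrtr_sqr.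
  have [y0|y0] := leP 0 y; [exists (acos x)|exists (- acos x)].
    by rewrite s ger0_norm.
  by rewrite cosN sinN s ltr0_norm // opprK.
exists (row_mx (base z) t%:M) => //.
rewrite /angle_chart row_mxKl row_mxKr mxE eqxx mulr1n ct st.
rewrite -[RHS]hsubmxK; congr row_mx; apply/rowP => i; rewrite !mxE /y /x.
rewrite mulrA expRN.
have [->|->] : i = 0 \/ i = 1.
  by case: i => [[|[|i]]] // Hi; [left|right]; apply/val_inj.
  by rewrite /= mulr1 mulr0 addr0 mxE.
by rewrite /= mulr0 add0r mulr1 mulrAC mulfV // mul1r mxE.
Qed.



End Lobachevsky.

(* Main.v *)
(* In the coordinates (u, v, theta) given by the frame X_1, X_2, the covariant
   derivative of a curve of unit vectors is (theta' + e^u v') eta, so the metric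
   of T_1 L^2 is du^2 + e^{2u} dv^2 + (dtheta + e^u dv)^2, which depends on u
   only.  The surface is the graph theta = a u + b, with constant coordinate
   vectors (1, 0, a) and (0, 1, 0); its normal N = -[(nabla xi)^* eta]^H + eta^V
   satisfies <<N, N>> = 2 + a^2 and pairs with A as A^theta - a A^u.  Thus the
   second fundamental form only involves the Christoffel symbols of T_1 L^2. *)
Require Import Defs.
From mathcomp Require Import all_boot all_order all_algebra.
From mathcomp Require Import all_classical all_reals all_analysis.
From mathcomp Require Import ring.

Set Implicit Arguments.
Unset Strict Implicit.
Unset Printing Implicit Defensive.

Import Order.TTheory GRing.Theory Num.Theory.
Import numFieldNormedType.Exports.
Local Open Scope ring_scope.

(** * Directional derivatives of matrix-valued maps *)

Lemma is_derive_mx (R : realFieldType) (V : normedModType R) (m n : nat)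
    (M : V -> 'M[R]_(m, n)) (dM : 'M[R]_(m, n)) (p v : V) :
  (forall i j, is_derive p v (fun q => M q i j) (dM i j)) ->
  is_derive p v M dM.
Proof.
move=> dE; have dMp : derivable M p v.
  by apply/derivable_mxP => i j; exact: (@ex_derive _ _ _ _ _ _ _ (dE i j)).
apply: DeriveDef => //; rewrite derive_mx //; apply/matrixP => i j.
by rewrite mxE (@derive_val _ _ _ _ _ _ _ (dE i j)).
Qed.

(** Chain rule through the linear map $N \mapsto N_{ij}$. The metrics and fields below are built
    from functions of a single coordinate, so their partial derivatives reduce to one-variable
    calculus. *)
Lemma is_derive_coord (R : realFieldType) (m n : nat) (h : R -> R) (dh : R)
    (M V : 'M[R]_(m, n)) (i : 'I_m) (j : 'I_n) :
  is_derive (M i j) 1 h dh -> is_derive M V (fun N => h (N i j)) (V i j * dh).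
Proof.
move=> [/derivable1_diffP dh1 dhE].
pose c (N : 'M[R]_(m, n)) := N i j : R.
have dc : differentiable c M by exact: differentiable_coord.
have dhc : differentiable (h \o c) M by exact: differentiable_comp.
have {}dhE : 'd h (c M) 1 = dh by rewrite -deriveE.
have dcE : 'd c M V = V i j.
  rewrite -deriveE //.
  have := derive_mx (@derivable_id _ _ M V).
  by rewrite derive_id => /matrixP/(_ i j); rewrite mxE => <-.
apply: (@DeriveDef _ _ _ _ _ (h \o c)); first exact: diff_derivable.
(* Writing [V i j] as [V i j * 1] lets linearity of the differential of [h] reduce it to its value
   at 1, which is [dh]. *)
rewrite deriveE // diff_comp //= dcE -[X in 'd h (c M) X](mulr1 (V i j)).
by rewrite linearZ /= dhE.
Qed.

(** * Small index sets and matrix algebra *)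

Lemma sum2E (V : nmodType) (F : 'I_2 -> V) : \sum_i F i = F 0 + F 1.
Proof.
rewrite !big_ord_recl big_ord0 addr0; congr (_ + F _); exact/val_inj.
Qed.

(* The coordinates u, v, theta of 'rV_(2 + 1) have the indices lshift 1 0,
   lshift 1 1 and rshift 2 0. *)
Lemma sum3E (V : nmodType) (F : 'I_(2 + 1) -> V) :
  \sum_i F i = F (lshift 1 0) + F (lshift 1 1) + F (rshift 2 0).
Proof. by rewrite big_split_ord sum2E big_ord1. Qed.

Lemma forall_ord2 (P : 'I_2 -> Prop) : P 0 -> P 1 -> forall i, P i.
Proof.
by move=> P0 P1 [[|[|//]] Hi]; [move: P0 | move: P1]; congr P; exact/val_inj.
Qed.

Lemma forall_ord3 (P : 'I_(2 + 1) -> Prop) :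
  P (lshift 1 0) -> P (lshift 1 1) -> P (rshift 2 0) -> forall i, P i.
Proof.
move=> P0 P1 P2 i; case: (split_ordP i) => j ->; last by rewrite ord1.
by move: j; exact: forall_ord2.
Qed.

Lemma forall_ord4 (P : 'I_(2 + 2) -> Prop) :
  P (lshift 2 0) -> P (lshift 2 1) -> P (rshift 2 0) -> P (rshift 2 1) ->
  forall i, P i.
Proof.
move=> P0 P1 P2 P3 i; case: (split_ordP i) => j ->; move: j;
  exact: forall_ord2.
Qed.

(** Over a commutative ring a one-sided inverse of a square matrix is two-sided, so an explicit
    inverse is certified by a single product. *)
Lemma mulmx1_invmx (R : comUnitRingType) n (A B : 'M[R]_n) :
  A *m B = 1%:M -> invmx A = B.
Proof.
by move=> AB; have [Au _] := mulmx1_unit AB; rewrite -[LHS]mulmx1 -AB mulKmx.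
Qed.

Lemma innerZl (R : realType) n (G : 'M[R]_n) k (X Y : 'rV_n) :
  inner G (k *: X) Y = k * inner G X Y.
Proof. by rewrite /inner -!scalemxAl mxE. Qed.

Lemma innerZr (R : realType) n (G : 'M[R]_n) k (X Y : 'rV_n) :
  inner G X (k *: Y) = k * inner G X Y.
Proof. by rewrite /inner linearZ /= -scalemxAr mxE. Qed.

Lemma connection_mapZ (R : realType) n (g : 'rV[R]_n -> 'M[R]_n) z k
    (A : 'rV[R]_(n + n)) :
  connection_map g z (k *: A) = k *: connection_map g z A.
Proof.
apply/rowP => i; rewrite !mxE mulrDr; congr (_ + _).
rewrite mulr_sumr; apply: eq_bigr => j _; rewrite mulr_sumr.
by apply: eq_bigr => l _; rewrite !mxE; ring.
Qed.

Lemma connection_map_hvlift (R : realType) n (g : 'rV[R]_n -> 'M[R]_n) z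
    (X Y : 'rV[R]_n) :
  connection_map g z (hlift g z X + vlift Y) = Y.
Proof.
rewrite /connection_map /hlift /vlift add_row_mx row_mxKl row_mxKr addr0.
by rewrite addrAC addNr add0r.
Qed.

(** * The metric of $L^2$ and its Levi-Civita connection *)

Section Lobachevsky.
Variable R : realType.
Implicit Types (Q X Y : 'rV[R]_2) (w A B : 'rV[R]_(2 + 1)).

Local Notation L2 := (@lobachevsky R).
Local Notation X1 := (@frame1 R).
Local Notation X2 := (@frame2 R).
Local Notation chart := (angle_chart X1 X2).
Local Notation sphere_metric := (unit_tangent_metric L2 X1 X2).

Lemma expR_neq0 (x : R) : expR x != 0.
Proof. by rewrite gt_eqF ?expR_gt0. Qed.

Lemma innerE (g : 'M[R]_2) X Y :
  inner g X Y = (X 0 0 * g 0 0 + X 0 1 * g 1 0) * Y 0 0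
              + (X 0 0 * g 0 1 + X 0 1 * g 1 1) * Y 0 1.
Proof. by rewrite /inner mxE sum2E !mxE !sum2E. Qed.

Lemma lobachevsky_inner Q X Y :
  inner (L2 Q) X Y
  = X 0 0 * Y 0 0 + expR (ucoord Q) ^+ 2 * X 0 1 * Y 0 1.
Proof.
rewrite innerE /lobachevsky !mxE /= expRM_natl; ring.
Qed.

Lemma invmx_lobachevsky Q :
  invmx (L2 Q)
  = diag_mx (\row_(i < 2) if i == 0 then 1 else expR (ucoord Q) ^- 2).
Proof.
have e0 := expR_neq0 (ucoord Q).
have E1 : L2 Q *m diag_mx
   (\row_(i < 2) if i == 0 then 1 else expR (ucoord Q) ^- 2) = 1%:M.
  apply/matrixP; apply: forall_ord2; apply: forall_ord2;
    rewrite mxE sum2E /lobachevsky !mxE /= ?expRM_natl; field => //.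
exact: mulmx1_invmx.
Qed.

Lemma is_derive_expRN (x : R) :
  is_derive x 1 (fun t => expR (- t)) (- expR (- x)).
Proof.
have := is_derive1_comp (is_derive_expR (- x)) (is_deriveNid x 1).
by rewrite mulrN1.
Qed.

Lemma is_derive_expR2M (x : R) :
  is_derive x 1 (fun t => expR (2 * t)) (2 * expR x ^+ 2).
Proof.
have d : is_derive x 1 (fun t : R => 2 * t) 2.
  have := is_deriveZ 2 (is_derive_id x 1).
  by rewrite /GRing.scale /= mulr1.
have := is_derive1_comp (is_derive_expR (2 * x)) d.
by rewrite mulrC expRM_natl.
Qed.

(** The only nonconstant entry is $g_{vv} = e^{2u}$, a function of $u$ alone. *)
Lemma pd_lobachevsky Q (l i j : 'I_2) :
  pd_metric L2 Q l i j =
   if [&& l == 0, i == 1 & j == 1] then 2 * expR (ucoord Q) ^+ 2 else 0.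
Proof.
rewrite /pd_metric; apply: derive_val.
(* An entry depending on $u$ only has derivative $h'(u)$ times the $u$-component of the basis
   vector, which is the indicator of [l == 0]. *)
have H (h : R -> R) dh : (forall q, L2 q i j = h (q 0 0)) ->
  is_derive (Q 0 0) 1 h dh ->
  is_derive Q (ebasis R l) (fun q => L2 q i j) ((l == 0)%:R * dh).
  move=> gE d; have -> : (fun q => L2 q i j) = fun q => h (q 0 0).
    exact/funext.
  have -> : (l == 0)%:R = ebasis R l 0 0 by rewrite mxE eqxx /= eq_sym.
  exact: is_derive_coord.
have D : is_derive Q (ebasis R l) (fun q => L2 q i j) ((l == 0)%:R *
    if (i == 1) && (j == 1) then 2 * expR (ucoord Q) ^+ 2 else 0).
  move: i j H; apply: forall_ord2; apply: forall_ord2 => /= H;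
    last (apply: H (is_derive_expR2M _) => q; by rewrite !mxE /=).
  - apply: (H (cst 1)) => q; by rewrite !mxE.
  - apply: (H (cst 0)) => q; by rewrite !mxE.
  - apply: (H (cst 0)) => q; by rewrite !mxE.
by apply: is_derive_eq D _; case: (l == 0); rewrite ?mul1r ?mul0r.
Qed.

(** The nonzero symbols are $\Gamma^u_{vv} = -e^{2u}$ and $\Gamma^v_{uv} = \Gamma^v_{vu} = 1$. *)
Lemma christoffel_form_lobachevsky Q X Y :
  christoffel_form L2 Q X Y =
  \row_i if i == 0 then - expR (ucoord Q) ^+ 2 * X 0 1 * Y 0 1
         else X 0 0 * Y 0 1 + X 0 1 * Y 0 0.
Proof.
have e0 := expR_neq0 (ucoord Q).
apply/rowP; apply: forall_ord2; rewrite !mxE !sum2E /christoffel !sum2E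
  !pd_lobachevsky invmx_lobachevsky !mxE /=; by field.
Qed.

(** Literal matrices as nested lists: after [mxE] every entry at a concrete index is found by
    computation. *)
Definition mx_of_rows m n (s : seq (seq R)) : 'M[R]_(m, n) :=
  \matrix_(i, j) nth 0 (nth [::] s i) j.

(** * The Sasaki metric in the coordinates $(u, v, \theta)$ *)

Lemma angle_chartE w :
  let u := w 0 (lshift 1 0) in let t := w 0 (rshift 2 0) in
  chart w = mx_of_rows 1 4
    [:: [:: u; w 0 (lshift 1 1); cos t; sin t * expR (- u)]].
Proof.
apply/rowP; apply: (@forall_ord4) => /=;
  rewrite /angle_chart ?row_mxEl ?row_mxEr !mxE /= ?ord1 //;
  rewrite /ucoord ?mxE ?mulr1 ?mulr0 ?addr0 ?add0r //.
Qed.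

Lemma derive_angle_chart w A :
  let u := w 0 (lshift 1 0) in let t := w 0 (rshift 2 0) in
  let Au := A 0 (lshift 1 0) in let At := A 0 (rshift 2 0) in
  'D_A chart w = mx_of_rows 1 4
    [:: [:: Au; A 0 (lshift 1 1); - sin t * At;
            cos t * At * expR (- u) - sin t * Au * expR (- u)]].
Proof.
move=> u t Au At; apply: derive_val; apply: is_derive_mx => i.
rewrite {i}(ord1 i).
have De : is_derive w A (fun q => expR (- q 0 (lshift 1 0)))
    (Au * - expR (- u)).
  exact: is_derive_coord (is_derive_expRN u).
have Ds := is_derive_coord A (is_derive_sin t).
have Dc := is_derive_coord A (is_derive_cos t).
have ext f j df : (forall q, chart q 0 j = f q) -> is_derive w A f df ->
  is_derive w A (fun q => chart q 0 j) df.
  by move=> /funext ->.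
apply: (@forall_ord4); rewrite mxE /=.
- apply: ext; first by move=> q; rewrite angle_chartE mxE.
  have := is_derive_coord A (is_derive_id u 1).
  by rewrite mulr1.
- apply: ext; first by move=> q; rewrite angle_chartE mxE.
  have := is_derive_coord A (is_derive_id (w 0 (lshift 1 1)) 1).
  by rewrite mulr1.
- apply: ext; first by move=> q; rewrite angle_chartE mxE.
  by apply: is_derive_eq Dc _; rewrite mulrC.
- apply: ext; first by move=> q; rewrite angle_chartE mxE.
  apply: is_derive_eq (is_deriveM Ds De) _;
  by rewrite /GRing.scale /= -/t -/u -/At; ring.
Qed.

(** The frame is parallel along $\partial_u$ and $\nabla_{\partial_v} X_1 = e^u X_2$, so the frame
    itself turns at rate $e^u v'$, which adds to $\theta'$. The constant angle function [cst t]
    serves to name $\eta$ at this one point. *)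
Lemma connection_chart w A :
  let u := w 0 (lshift 1 0) in let t := w 0 (rshift 2 0) in
  connection_map L2 (chart w) ('D_A chart w) =
  (A 0 (rshift 2 0) + expR u * A 0 (lshift 1 1)) *:
   angle_conormal X1 X2 (cst t) (lsubmx w).
Proof.
move=> u t; have e0 := expR_neq0 u.
rewrite /connection_map christoffel_form_lobachevsky derive_angle_chart.
apply/rowP; apply: forall_ord2; rewrite angle_chartE !mxE /= /ucoord !mxE /=
 -/u -/t expRN /=; field => //.
Qed.

Lemma sasaki_chart w A B :
  let u := w 0 (lshift 1 0) in
  sasaki L2 (chart w) ('D_A chart w) ('D_B chart w) =
  A 0 (lshift 1 0) * B 0 (lshift 1 0)
  + expR u ^+ 2 * A 0 (lshift 1 1) * B 0 (lshift 1 1)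
  + (A 0 (rshift 2 0) + expR u * A 0 (lshift 1 1))
   * (B 0 (rshift 2 0) + expR u * B 0 (lshift 1 1)).
Proof.
move=> u; have e0 := expR_neq0 u.
set t := w 0 (rshift 2 0).
have dpE V : dproj ('D_V chart w) = lsubmx V.
  by apply/rowP; apply: forall_ord2; rewrite /dproj derive_angle_chart !mxE.
have uE : ucoord (base (chart w)) = u by rewrite angle_chartE /ucoord !mxE.
transitivity (inner (L2 (base (chart w))) (lsubmx A) (lsubmx B)
  + inner (L2 (base (chart w)))
    ((A 0 (rshift 2 0) + expR u * A 0 (lshift 1 1)) *:
       angle_conormal X1 X2 (cst t) (lsubmx w))
    ((B 0 (rshift 2 0) + expR u * B 0 (lshift 1 1)) *:
       angle_conormal X1 X2 (cst t) (lsubmx w))).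
  exact: (congr2 +%R (congr2 (inner _) (dpE A) (dpE B))
    (congr2 (inner _) (connection_chart w A) (connection_chart w B))).
move: (A 0 (rshift 2 0) + _) (B 0 (rshift 2 0) + _) => p q.
rewrite !lobachevsky_inner uE !mxE /= /ucoord !mxE /= expRN -/u -/t.
(* The vertical parts are $p\eta$ and $q\eta$; $|\eta|^2 = 1$ enters as the Pythagorean identity,
   which [field] cannot supply. *)
have -> : p * q = p * q * (cos t ^+ 2 + sin t ^+ 2).
  by rewrite cos2Dsin2 mulr1.
by field.
Qed.

(** * The metric of $T_1L^2$ and its Christoffel symbols *)

Lemma unit_tangent_metricE w :
  let u := w 0 (lshift 1 0) in
  sphere_metric w =
  mx_of_rows 3 3 [:: [:: 1; 0; 0]; [:: 0; 2 * expR u ^+ 2; expR u];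
                     [:: 0; expR u; 1]].
Proof.
move=> u; apply/matrixP; apply: forall_ord3; apply: forall_ord3;
 rewrite !mxE sasaki_chart !mxE /= -/u; ring.
Qed.

Lemma invmx_unit_tangent_metric w :
  let u := w 0 (lshift 1 0) in
  invmx (sphere_metric w) =
  mx_of_rows 3 3 [:: [:: 1; 0; 0]; [:: 0; expR u ^- 2; - (expR u)^-1];
                     [:: 0; - (expR u)^-1; 2]].
Proof.
move=> u; have e0 := expR_neq0 u.
set G := unit_tangent_metric _ _ _ _; set H := mx_of_rows _ _ _.
have E1 : G *m H = 1%:M.
  rewrite /G unit_tangent_metricE.
  apply/matrixP; apply: forall_ord3; apply: forall_ord3;
   rewrite mxE sum3E !mxE /= -/u; field => //.
exact: mulmx1_invmx.
Qed.

Lemma pd_unit_tangent_metric w (l i j : 'I_(2 + 1)) :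
  let u := w 0 (lshift 1 0) in
  pd_metric sphere_metric w l i j
  = (l == lshift 1 0)%:R *
    mx_of_rows 3 3 [:: [:: 0; 0; 0]; [:: 0; 4 * expR u ^+ 2; expR u];
                     [:: 0; expR u; 0]] i j.
Proof.
move=> u; rewrite /pd_metric; apply: derive_val.
have H (h : R -> R) dh :
    (forall q, sphere_metric q i j = h (q 0 (lshift 1 0))) ->
  is_derive (w 0 (lshift 1 0)) 1 h dh ->
  is_derive w (ebasis R l) (fun q => sphere_metric q i j)
    ((l == lshift 1 0)%:R * dh).
  move=> /funext -> d.
  have -> : (l == lshift 1 0)%:R = ebasis R l 0 (lshift 1 0).
    by rewrite mxE eqxx /= eq_sym.
  exact: is_derive_coord.
(* The four vanishing entries are closed by [try]; the bullets treat the two entries equal to 1 and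
   the $(v,\theta)$ block. *)
move: i j H; apply: forall_ord3; apply: forall_ord3 => H; rewrite mxE /=;
  try by (apply: (H (cst 0)) => q; rewrite unit_tangent_metricE mxE).
- by apply: (H (cst 1)) => q; rewrite unit_tangent_metricE mxE.
- apply: (H (fun t => 2 * expR (2 * t))).
    by move=> q; rewrite unit_tangent_metricE mxE /= expRM_natl.
  apply: is_derive_eq (is_deriveZ 2 (is_derive_expR2M u)) _.
  rewrite /GRing.scale /=; ring.
- by apply: (H expR) => q; rewrite unit_tangent_metricE mxE.
- by apply: (H expR) => q; rewrite unit_tangent_metricE mxE.
- by apply: (H (cst 1)) => q; rewrite unit_tangent_metricE mxE.
Qed.

(** As $G$ depends on $u$ only, the $u$-component is $-\frac12 (\partial_u G)(A, B)$. The $v$ and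
    $\theta$ components come from $\frac12 G^{-1} \partial_u G$ applied to the symmetrized products
    [cv] and [ct]. *)
Lemma christoffel_form_unit_tangent w A B :
  let u := w 0 (lshift 1 0) in
  let c i := A 0 (lshift 1 0) * B 0 i + A 0 i * B 0 (lshift 1 0) in
  let cv := c (lshift 1 1) in let ct := c (rshift 2 0) in
  let Av := A 0 (lshift 1 1) in let At := A 0 (rshift 2 0) in
  let Bv := B 0 (lshift 1 1) in let Bt := B 0 (rshift 2 0) in
  christoffel_form sphere_metric w A B
  = mx_of_rows 1 3 [:: [::
      - 2 * expR u ^+ 2 * Av * Bv - expR u / 2 * (Av * Bt + At * Bv);
      3 / 2 * cv + (2 * expR u)^-1 * ct;
      - expR u * cv - ct / 2]].
Proof.
move=> u c cv ct Av At Bv Bt.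
have e0 := expR_neq0 u.
apply/rowP; apply: forall_ord3; rewrite !mxE !sum3E /christoffel !sum3E
  !pd_unit_tangent_metric invmx_unit_tangent_metric !mxE /=
  -/u /cv /ct /c -/Av -/At -/Bv -/Bt; by field.
Qed.

(** * The section as an affine graph over the $(u, v)$-plane *)

Lemma is_derive_affine (a b x : R) :
  is_derive x 1 (fun t => a * t + b) a.
Proof.
have := is_deriveD (is_deriveZ a (is_derive_id x 1)) (is_derive_cst b x 1).
by rewrite addr0 /GRing.scale /= mulr1.
Qed.

Lemma is_derive_affine_ucoord (a b : R) Q Y :
  is_derive Q Y (fun P => a * ucoord P + b) (a * Y 0 0).
Proof.
rewrite mulrC; apply: (is_derive_coord (h := fun x => a * x + b)).
exact: is_derive_affine.
Qed.

Lemma derive_angle_section (a b : R) Q Y :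
  'D_Y (angle_section (fun P => a * ucoord P + b)) Q =
  row_mx Y (a * Y 0 0)%:M.
Proof.
apply: derive_val; apply: is_derive_mx => i; rewrite {i}(ord1 i).
pose omega P := a * ucoord P + b; rewrite -/omega.
have ext f j df : (forall q, angle_section omega q 0 j = f q) ->
    is_derive Q Y f df ->
  is_derive Q Y (fun q => angle_section omega q 0 j) df.
  by move=> /funext ->.
apply: forall_ord3; rewrite ?row_mxEl ?row_mxEr.
- apply: ext; first by move=> q; rewrite /angle_section row_mxEl.
  by have := is_derive_coord Y (is_derive_id (Q 0 0) 1); rewrite mulr1.
- apply: ext; first by move=> q; rewrite /angle_section row_mxEl.
  by have := is_derive_coord Y (is_derive_id (Q 0 1) 1); rewrite mulr1.
- apply: ext; first by move=> q; rewrite /angle_section row_mxEr mxE.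
  rewrite mxE eqxx mulr1n; exact: is_derive_affine_ucoord.
Qed.

(** * The field $\xi$, its covariant derivative and the unit normal *)

Section AffineAngle.
Variables a b : R.
Let omega := fun P : 'rV[R]_2 => a * ucoord P + b.
Let xi := angle_field X1 X2 omega.
Let eta := angle_conormal X1 X2 omega.

(** The rotation rate of $\xi$ along $Y$ is $d\omega(Y) = a Y^u$ plus the rate $e^u Y^v$ of the
    frame. *)
Lemma nabla_affine_angle_field Q Y :
  nabla L2 xi Q Y =
  (a * Y 0 0 + expR (ucoord Q) * Y 0 1) *: eta Q.
Proof.
have e0 := expR_neq0 (ucoord Q).
have D (h : R -> R) dh : is_derive (omega Q) 1 h dh ->
    is_derive Q Y (fun P => h (omega P)) (a * Y 0 0 * dh).
  move=> d; have -> : a * Y 0 0 * dh = Y 0 0 * (dh * a) by ring.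
  apply: (is_derive_coord (h := fun x => h (a * x + b))).
  exact: (@is_derive1_comp _ h (fun x => a * x + b) _ _ _ d
    (is_derive_affine a b (Q 0 0))).
have De : is_derive Q Y (fun P => expR (- ucoord P))
    (Y 0 0 * - expR (- ucoord Q)).
  exact: is_derive_coord (is_derive_expRN (ucoord Q)).
have dxi : 'D_Y xi Q = \row_i
    if i == 0 then a * Y 0 0 * - sin (omega Q)
    else (a * Y 0 0 * cos (omega Q) - Y 0 0 * sin (omega Q))
         / expR (ucoord Q).
  apply: derive_val; apply: is_derive_mx => i; rewrite {i}(ord1 i).
  apply: forall_ord2; rewrite mxE /=.
  - rewrite (_ : (fun q => _) = fun q => cos (omega q)); first exact: D.
    by apply/funext => q; rewrite !mxE /= mulr1 !mulr0 addr0.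
  - rewrite (_ : (fun q => _) = fun q => sin (omega q) * expR (- ucoord q)).
      apply: is_derive_eq (is_deriveM (D _ _ (is_derive_sin _)) De) _.
      by rewrite /GRing.scale /= expRN; ring.
    by apply/funext => q; rewrite !mxE /= mulr0 add0r mulr1.
rewrite /nabla dxi christoffel_form_lobachevsky.
apply/rowP; apply: forall_ord2; rewrite !mxE /= expRN; field => //.
Qed.

Lemma inner_conormal Q : inner (L2 Q) (eta Q) (eta Q) = 1.
Proof.
have e0 := expR_neq0 (ucoord Q).
rewrite lobachevsky_inner !mxE /= expRN.
transitivity (cos (omega Q) ^+ 2 + sin (omega Q) ^+ 2); last exact: cos2Dsin2.
by field.
Qed.

(** The covector $Y \mapsto \langle \eta, \nabla_Y \xi \rangle$ has components $(a, e^u)$; raising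
    the index with $g^{-1}$ divides the second by $e^{2u}$. *)
Lemma nabla_adj_affine_angle_field Q :
  nabla_adj L2 xi Q (eta Q)
  = \row_i if i == 0 then a else (expR (ucoord Q))^-1.
Proof.
have e0 := expR_neq0 (ucoord Q).
rewrite /nabla_adj invmx_lobachevsky.
have -> : eta Q *m L2 Q *m (nabla_mx L2 xi Q)^T =
   \row_i if i == 0 then a else expR (ucoord Q).
  apply/rowP => i; rewrite mxE.
  transitivity (inner (L2 Q) (eta Q)
     ((a * ebasis R i 0 0 + expR (ucoord Q) * ebasis R i 0 1) *: eta Q)).
    rewrite -nabla_affine_angle_field /inner mxE; apply: eq_bigr => k _.
    by rewrite !mxE.
  rewrite innerZr inner_conormal.
  move: i; apply: forall_ord2; rewrite !mxE /=; ring.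
by rewrite mul_mx_diag; apply/rowP; apply: forall_ord2; rewrite !mxE /=; field.
Qed.

Lemma dproj_normal_field Q :
  dproj (normal_field L2 xi eta Q) =
  \row_i if i == 0 then - a else - (expR (ucoord Q))^-1.
Proof.
rewrite /dproj /normal_field /hlift /vlift add_row_mx row_mxKl addr0.
rewrite nabla_adj_affine_angle_field.
by apply/rowP; apply: forall_ord2; rewrite !mxE.
Qed.

Lemma connection_normal_field Q :
  connection_map L2 (section xi Q) (normal_field L2 xi eta Q) = eta Q.
Proof. exact: connection_map_hvlift. Qed.

(** The horizontal part contributes $a^2 + e^{2u} e^{-2u} = a^2 + 1$ and the vertical part $|\eta|^2
    = 1$. *)
Lemma sasaki_normal_field Q :
  let N := normal_field L2 xi eta Q in
  sasaki L2 (section xi Q) N N = 2 + a ^+ 2.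
Proof.
move=> N; have e0 := expR_neq0 (ucoord Q).
rewrite /sasaki connection_normal_field dproj_normal_field.
rewrite (_ : base (section xi Q) = Q); last exact: row_mxKl.
by rewrite inner_conormal lobachevsky_inner !mxE /=; field.
Qed.

(** The horizontal pairing is $-a A^u - e^u A^v$ and the vertical one $A^\theta + e^u A^v$, so the
    $A^v$ terms cancel. Taking $A$ tangent to the graph gives 0, as a normal must. *)
Lemma sasaki_unit_normal Q A :
  sasaki L2 (chart (angle_section omega Q))
   ('D_A chart (angle_section omega Q))
   (unit_normal L2 xi eta Q)
  = (A 0 (rshift 2 0) - a * A 0 (lshift 1 0)) / Num.sqrt (2 + a ^+ 2).
Proof.
have e0 := expR_neq0 (ucoord Q).
rewrite /unit_normal sasaki_normal_field.
set k := _^-1; set N := normal_field _ _ _ _.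
set w := angle_section omega Q.
have uE : w 0 (lshift 1 0) = ucoord Q by rewrite /w row_mxEl.
have dpE : dproj ('D_A chart w) = lsubmx A.
  by apply/rowP; apply: forall_ord2; rewrite /dproj derive_angle_chart !mxE.
have cE : connection_map L2 (chart w) ('D_A chart w)
   = (A 0 (rshift 2 0) + expR (ucoord Q) * A 0 (lshift 1 1)) *: eta Q.
  rewrite connection_chart uE; congr (_ *: _).
  rewrite /angle_conormal /w /angle_section row_mxKl row_mxEr mxE eqxx.
  by rewrite mulr1n.
have zE : chart w = section xi Q := angle_chart_section _ _ _ _.
transitivity (inner (L2 Q) (lsubmx A) (k *: dproj N)
  + inner (L2 Q)
    ((A 0 (rshift 2 0) + expR (ucoord Q) * A 0 (lshift 1 1)) *: eta Q)
    (k *: eta Q)).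
  have bE : base (section xi Q) = Q by exact: row_mxKl.
  have kN : connection_map L2 (section xi Q) (k *: N) = k *: eta Q.
    by rewrite connection_mapZ connection_normal_field.
  have dN : dproj (k *: N) = k *: dproj N by exact: linearZ.
  rewrite zE in cE *; rewrite /sasaki bE.
  exact: (congr2 +%R (congr2 (inner _) dpE dN) (congr2 (inner _) cE kN)).
rewrite /N dproj_normal_field !innerZr innerZl inner_conormal.
by rewrite lobachevsky_inner !mxE /=; field.
Qed.

(** * Fundamental forms and mean curvature *)

Lemma first_form_affine_angle Q :
  first_form L2 X1 X2 (angle_section omega) Q =
  mx_of_rows 2 2 [:: [:: 1 + a ^+ 2; a * expR (ucoord Q)];
                     [:: a * expR (ucoord Q); 2 * expR (ucoord Q) ^+ 2]].
Proof.
have inner3 (G : 'M[R]_(2 + 1)) A B : inner G A B =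
   \sum_j (\sum_i A 0 i * G i j) * B 0 j.
  by rewrite /inner mxE; apply: eq_bigr => j _; rewrite !mxE.
apply/matrixP; apply: forall_ord2; apply: forall_ord2;
  rewrite !mxE inner3 !derive_angle_section unit_tangent_metricE !sum3E
    !row_mxEl !row_mxEr !mxE /= -/(ucoord Q); ring.
Qed.

(** The determinant of the first form is $2E^2(1 + a^2) - a^2E^2 = E^2(2 + a^2)$, which never
    vanishes. *)
Lemma invmx_first_form_affine_angle Q : let E := expR (ucoord Q) in
  invmx (first_form L2 X1 X2 (angle_section omega) Q) =
  mx_of_rows 2 2 [:: [:: 2 / (2 + a ^+ 2); - a / (E * (2 + a ^+ 2))];
    [:: - a / (E * (2 + a ^+ 2)); (1 + a ^+ 2) / (E ^+ 2 * (2 + a ^+ 2))]].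
Proof.
move=> E; have e0 : E != 0 := expR_neq0 _.
have a0 : 2 + a ^+ 2 != 0 by rewrite gt_eqF // ltr_pwDl // sqr_ge0.
set G := first_form _ _ _ _ _; set H := mx_of_rows _ _ _.
have E1 : G *m H = 1%:M.
  rewrite /G first_form_affine_angle.
  by apply/matrixP; apply: forall_ord2; apply: forall_ord2;
   rewrite mxE sum2E !mxE /= -/E; field; rewrite ?e0 ?a0.
exact: mulmx1_invmx.
Qed.

Lemma second_form_affine_angle Q : let E := expR (ucoord Q) in
  second_form L2 X1 X2 (angle_section omega) (unit_normal L2 xi eta) Q =
  (Num.sqrt (2 + a ^+ 2))^-1 *:
    mx_of_rows 2 2 [:: [:: - a; (a ^+ 2 / 2 - 1) * E];
                       [:: (a ^+ 2 / 2 - 1) * E; 2 * a * E ^+ 2]].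
Proof.
move=> E; have e0 : E != 0 := expR_neq0 _.
(* The graph is affine, so its coordinate vector fields are constant and only the Christoffel term
   of [nabla_along] survives. *)
have dD i j : 'D_(ebasis R i) ('D_(ebasis R j) (angle_section omega)) Q = 0.
  rewrite (_ : 'D_(ebasis R j) (angle_section omega) =
    cst (row_mx (ebasis R j) (a * ebasis R j 0 0)%:M)) ?derive_cst //.
  by apply/funext => P; rewrite derive_angle_section.
have uE : angle_section omega Q 0 (lshift 1 0) = ucoord Q by rewrite row_mxEl.
apply/matrixP => i j; rewrite mxE sasaki_unit_normal mulrC.
rewrite [RHS]mxE; congr (_ * _).
rewrite /nabla_along dD add0r !derive_angle_section.
rewrite christoffel_form_unit_tangent uE -/E.
move: i j; apply: forall_ord2; apply: forall_ord2;
  rewrite /= !row_mxEl !row_mxEr !mxE /=; field => //.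
Qed.

(** All powers of $E = e^u$ cancel in the trace, which makes $H$ constant. What remains is $a(2 +
    a^2)$ over $(2 + a^2)\sqrt{2 + a^2}$, before the factor $\frac12$. *)
Lemma mean_curvature_affine_angle Q :
  mean_curvature L2 X1 X2 (angle_section omega) (unit_normal L2 xi eta) Q
  = a / (2 * Num.sqrt (2 + a ^+ 2)).
Proof.
have e0 := expR_neq0 (ucoord Q).
have a0 : 0 < 2 + a ^+ 2 by rewrite ltr_pwDl // sqr_ge0.
have s0 : Num.sqrt (2 + a ^+ 2) != 0 by rewrite gt_eqF // sqrtr_gt0.
have a0' := lt0r_neq0 a0.
rewrite /mean_curvature invmx_first_form_affine_angle second_form_affine_angle.
rewrite -scalemxAr mxtraceZ /mxtrace sum2E !mxE !sum2E !mxE /=.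
by field; rewrite e0 s0 a0'.
Qed.

End AffineAngle.

End Lobachevsky.

Theorem proposition3p6p1 (R : realType) (a b : R) (Q : 'rV[R]_2) :
  let omega := fun P : 'rV[R]_2 => a * ucoord P + b in
  let xi := angle_field (@frame1 R) (@frame2 R) omega in
  let eta := angle_conormal (@frame1 R) (@frame2 R) omega in
  mean_curvature (@lobachevsky R) (@frame1 R) (@frame2 R)
    (angle_section omega) (unit_normal (@lobachevsky R) xi eta) Q
  = a / (2 * Num.sqrt (2 + a ^+ 2)).
Proof. exact: mean_curvature_affine_angle. Qed.
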